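(* Let $G$ be a finite group and $\rho\colon G\to\mathrm{Aut}^+(E)$ a positive representation in a nonzero finite dimensional Archimedean Riesz space $E$. Let $\{B_i\}_{i\in I}$ be the set of irreducible invariant bands in $E$. Then $E=\bigoplus_{i\in I}B_i$ as an order direct sum. Furthermore, any $\rho$-invariant band in $E$ is a direct sum of $B_i$'s.
   Context: All Riesz spaces (vector lattices) are real. $\mathrm{Aut}^+(E)$ denotes the group of lattice automorphisms of $E$. A positive representation of $G$ in $E$ is a group homomorphism $\rho\colon G\to\mathrm{Aut}^+(E)$, $s\mapsto\rho_s$. A band $B$ is $\rho$-invariant if $\rho_sB\subset B$ for all $s\in G$; it is then a finite dimensional Archimedean Riesz space carrying the restricted positive representation. In a finite dimensional Archimedean Riesz space the ideals, (principal) bands and projection bands coincide, and a positive representation in such a space is called irreducible if the only invariant bands are $\{0\}$ and the whole space. An irreducible invariant band is a $\rho$-invariant band $B$ such that the restriction of $\rho$ to $B$ is irreducible. An order direct sum is a vector space direct sum in which an element is positive if and only if all its components are positive. *)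

(* Defs.v *)
From HB Require Import structures.
From mathcomp Require Import all_boot all_order all_algebra all_fingroup.
From mathcomp Require Import classical_sets reals.

Set Implicit Arguments.
Unset Strict Implicit.
Unset Printing Implicit Defensive.

Import Order.TTheory GRing.Theory Num.Theory.

Local Open Scope ring_scope.

(* MathComp has no common substructure of lattices and additive groups below  *)
(* its number structures, so that a structure inheriting from both its        *)
(* lattices and its modules is rejected by Hierarchy-Builder. Hence the       *)
(* binary suprema and infima are operations of the mixin.                     *)
HB.mixin Record POrderedLmodule_isRiesz (R : numDomainType) E
    of Num.POrderedZmodule E & GRing.Lmodule R E := {
  riesz_join : E -> E -> E ;
  riesz_meet : E -> E -> E ;
  riesz_leUx : forall x y z : E,
    (riesz_join x y <= z) = (x <= z) && (y <= z) ;
  riesz_lexI : forall x y z : E,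
    (z <= riesz_meet x y) = (z <= x) && (z <= y) ;
  riesz_leD2r : forall z x y : E, x <= y -> x + z <= y + z ;
  riesz_scale_ge0 : forall (a : R) (x : E), 0 <= a -> 0 <= x -> 0 <= a *: x
}.

#[short(type="rieszType")]
HB.structure Definition Riesz (R : numDomainType) :=
  { E of POrderedLmodule_isRiesz R E & Num.POrderedZmodule E
       & GRing.Lmodule R E }.

#[short(type="finDimRieszType")]
HB.structure Definition FinDimRiesz (R : numDomainType) :=
  { E of Riesz R E & Vector R E }.

Definition archimedean_riesz (R : numDomainType) (E : rieszType R) : Prop :=
  forall x y : E, 0 <= x -> (forall n : nat, x *+ n <= y) -> x = 0.

Definition riesz_abs (R : numDomainType) (E : rieszType R) (x : E) : E :=
  riesz_join x (- x).

Section Bands.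
Variables (R : realType) (E : finDimRieszType R).
Implicit Types (V B C : {vspace E}) (D : set E) (s : seq {vspace E}).

(* The notions below are relative to a subspace V of E, meant to be E itself  *)
(* ([fullv]) or a band of E. Such a V is a Riesz subspace, so the absolute    *)
(* value of V is that of E, whereas the suprema of subsets of V are taken     *)
(* among the upper bounds that lie in V.                                      *)
Definition supremum_in V D (x : E) : Prop :=
  [/\ x \in V, ubound D x & forall y, y \in V -> ubound D y -> x <= y].

Definition ideal_in V B : Prop :=
  (B <= V)%VS /\
  forall x y, x \in V -> y \in B -> riesz_abs x <= riesz_abs y -> x \in B.

Definition band_in V B : Prop :=
  ideal_in V B /\
  forall D x, (forall y, D y -> y \in B) -> supremum_in V D x -> x \in B.

Definition band B : Prop := band_in fullv B.

(* V is the order direct sum of the subspaces in the set S. The enumeration   *)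
(* s of S is without repetition, so a family of components is a function that *)
(* sends each B in S to an element of B. Since E is finite dimensional, only  *)
(* finite sets S can be in direct sum.                                        *)
Definition order_direct_sum (S : set {vspace E}) V : Prop :=
  exists s,
    [/\ uniq s,
        forall B, S B <-> B \in s,
        directv (\sum_(B <- s) B)%VS,
        (\sum_(B <- s) B)%VS = V
      & forall x : {vspace E} -> E, (forall B, B \in s -> x B \in B) ->
          0 <= \sum_(B <- s) x B <-> (forall B, B \in s -> 0 <= x B)].

Definition lattice_automorphism (f : 'End(E)) : Prop :=
  [/\ bijective f,
      {morph f : x y / riesz_join x y} & {morph f : x y / riesz_meet x y}].

Section Representations.
Variable G : finGroupType.

Definition positive_representation (rho : G -> 'End(E)) : Prop :=
  (forall g, lattice_automorphism (rho g)) /\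
  (forall g h, rho (g * h)%g = (rho g \o rho h)%VF).

Definition rho_invariant (rho : G -> 'End(E)) B : Prop :=
  forall g, (rho g @: B <= B)%VS.

(* The zero subspace satisfies this condition, so it belongs to               *)
(* [irreducible_invariant_band]; a zero summand does not affect direct sums.  *)
Definition irreducible_on (rho : G -> 'End(E)) V : Prop :=
  forall B, band_in V B -> rho_invariant rho B -> B = 0%VS \/ B = V.

Definition irreducible_invariant_band (rho : G -> 'End(E)) : set {vspace E} :=
  fun B => [/\ band B, rho_invariant rho B & irreducible_on rho B].

End Representations.
End Bands.

(* Main.v *)
(* A pairwise disjoint family of positive vectors is free, so there is one of *)
(* maximal size. Maximality and the Archimedean property make its members     *)
(* atoms and make it a basis in which the order of E is coordinatewise. The   *)
(* bands are then the spans of sets of atoms. Each rho g maps an atom to a    *)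
(* positive multiple of an atom, hence G permutes the rays of the atoms, the  *)
(* invariant bands are the spans of unions of orbits, and the irreducible     *)
(* ones are 0 and the spans of single orbits.                                 *)
Require Import Defs.
From mathcomp Require Import all_boot all_order all_algebra all_fingroup.
From mathcomp Require Import boolp classical_sets reals.
From mathcomp Require Import fintype finset.

Set Implicit Arguments.
Unset Strict Implicit.
Unset Printing Implicit Defensive.

Import Order.TTheory GRing.Theory Num.Theory.

Local Open Scope ring_scope.

(** [atom_basis] identifies [E] with a real coordinate space under the coordinatewise order. Its
    engine is [maximal_disjoint_atom]: in a disjoint family of maximal size no member dominates two
    nonzero disjoint vectors, and the Archimedean property then makes every vector between 0 and a
    member a multiple of that member. Subtracting from a positive vector its largest admissible
    multiples of the members leaves a vector disjoint from the whole family, hence zero. In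
    coordinates the bands are exactly the spans of sets of basis vectors ([ideal_atom_span],
    [band_atom_span]), and a lattice automorphism sends each basis vector to a multiple of another
    ([rho_atom]). What remains is combinatorial: orbits partition the indices, and a stable set of
    indices is the disjoint union of the orbits inside it. [order_direct_sum_atom_span] turns
    disjoint unions into order direct sums. *)

Section RieszTheory.
Variables (R : realType) (E : rieszType R).
Implicit Types (x y z u v : E) (a c d : R).

(** * Inequalities in an ordered vector space *)

Lemma riesz_leDr x y z : (x + z <= y + z) = (x <= y).
Proof.
apply/idP/idP => [/(riesz_leD2r (- z))|/riesz_leD2r]; last exact.
by rewrite !addrK.
Qed.

Lemma riesz_subr_ge0 x y : (0 <= y - x) = (x <= y).
Proof. by rewrite -(riesz_leDr 0 _ x) add0r subrK. Qed.

Lemma riesz_lerBlDr x y z : (x - y <= z) = (x <= z + y).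
Proof. by rewrite -(riesz_leDr (x - y) z y) subrK. Qed.

Lemma riesz_lerBrDr x y z : (x <= y - z) = (x + z <= y).
Proof. by rewrite -(riesz_leDr x _ z) subrK. Qed.

Lemma riesz_leD x y u v : x <= y -> u <= v -> x + u <= y + v.
Proof.
move=> xy uv; apply: (@le_trans _ _ (y + u)); first by rewrite riesz_leDr.
by rewrite ![y + _]addrC riesz_leDr.
Qed.

Lemma riesz_leN x y : (- x <= - y) = (y <= x).
Proof. by rewrite -(riesz_subr_ge0 (- x)) opprK addrC riesz_subr_ge0. Qed.

Lemma riesz_lerDl x y : 0 <= y -> x <= x + y.
Proof. by move=> y0; rewrite -{1}[x]addr0 riesz_leD. Qed.

Lemma riesz_leZl a x y : 0 <= a -> x <= y -> a *: x <= a *: y.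
Proof.
move=> a0; rewrite -riesz_subr_ge0 -(riesz_subr_ge0 (a *: x)) -scalerBr.
exact: riesz_scale_ge0.
Qed.

Lemma riesz_leZr a c x : 0 <= x -> a <= c -> a *: x <= c *: x.
Proof.
move=> x0 ac; rewrite -riesz_subr_ge0 -scalerBl.
by apply: riesz_scale_ge0 => //; rewrite subr_ge0.
Qed.

Lemma riesz_sum_ge0 (I : Type) (r : seq I) (P : pred I) (F : I -> E) :
  (forall i, P i -> 0 <= F i) -> 0 <= \sum_(i <- r | P i) F i.
Proof.
move=> F0; elim/big_ind: _ => // x y x0 y0.
exact: le_trans x0 (riesz_lerDl _ y0).
Qed.

(** * Positive parts and disjointness *)

Definition riesz_pos x := riesz_join x 0.

Lemma riesz_pos_ge0 x : 0 <= riesz_pos x.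
Proof. by have := lexx (riesz_pos x); rewrite riesz_leUx => /andP[]. Qed.

Lemma riesz_le_pos x : x <= riesz_pos x.
Proof. by have := lexx (riesz_pos x); rewrite riesz_leUx => /andP[]. Qed.

Lemma riesz_pos_le x y : (riesz_pos x <= y) = (x <= y) && (0 <= y).
Proof. exact: riesz_leUx. Qed.

Lemma riesz_pos_eq0 x : riesz_pos x = 0 -> x <= 0.
Proof. by move=> <-; apply: riesz_le_pos. Qed.

Lemma riesz_posB x : x = riesz_pos x - riesz_pos (- x).
Proof.
apply/eqP; rewrite eq_sym subr_eq; apply/eqP/le_anti/andP; split.
  rewrite riesz_pos_le riesz_lerDl ?riesz_pos_ge0 //=.
  by rewrite addrC -riesz_lerBlDr sub0r riesz_le_pos.
rewrite addrC -riesz_lerBrDr riesz_pos_le.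
by rewrite riesz_lerBrDr addNr riesz_pos_ge0 riesz_subr_ge0 riesz_le_pos.
Qed.

(** For positive vectors the meet is automatically nonnegative, so [<= 0] says that it vanishes. *)
Definition riesz_disjoint x y :=
  [&& 0 <= x, 0 <= y & riesz_meet x y <= 0].

Lemma riesz_disjointP x y :
  reflect [/\ 0 <= x, 0 <= y & forall z, z <= x -> z <= y -> z <= 0]
          (riesz_disjoint x y).
Proof.
apply: (iffP and3P) => -[x0 y0 xy]; split => //.
  by move=> z zx zy; apply: le_trans xy; rewrite riesz_lexI zx.
by apply: xy; have := lexx (riesz_meet x y); rewrite riesz_lexI => /andP[].
Qed.

Lemma riesz_disjointC x y : riesz_disjoint x y = riesz_disjoint y x.
Proof.
by apply/riesz_disjointP/riesz_disjointP => -[x0 y0 xy]; split=> // z *;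
  apply: xy.
Qed.

Lemma riesz_disjoint0 x : 0 <= x -> riesz_disjoint x 0.
Proof. by move=> x0; apply/riesz_disjointP; split. Qed.

(** If [w] is below [x] and [y + z], then [w - z] is below [x] and [y], hence [w <= z], and
    disjointness of [x] and [z] finishes. No distributive law is involved. *)
Lemma riesz_disjointD x y z :
  riesz_disjoint x y -> riesz_disjoint x z -> riesz_disjoint x (y + z).
Proof.
move=> /riesz_disjointP[x0 y0 xy] /riesz_disjointP[_ z0 xz].
apply/riesz_disjointP; split=> // [|w wx wyz].
  exact: le_trans y0 (riesz_lerDl _ z0).
apply: xz => //; rewrite -riesz_subr_ge0 -riesz_leN oppr0 opprB.
apply: xy; last by rewrite riesz_lerBlDr.
by apply: le_trans wx; rewrite riesz_lerBlDr riesz_lerDl.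
Qed.

Lemma riesz_disjoint_le x y z :
  riesz_disjoint x y -> 0 <= z -> z <= y -> riesz_disjoint x z.
Proof.
move=> /riesz_disjointP[x0 y0 xy] z0 zy.
apply/riesz_disjointP; split => // w wx wz.
by apply: xy => //; apply: le_trans zy.
Qed.

(** The factor is enlarged to [1 + a], which is at least 1: dividing a lower bound of [x] and
    [(1 + a) *: y] by it gives a lower bound of [x] and [y]. *)
Lemma riesz_disjointZ a x y :
  0 <= a -> riesz_disjoint x y -> riesz_disjoint x (a *: y).
Proof.
move=> a0 xy; have /riesz_disjointP[x0 y0 dxy] := xy.
have c0 : 0 < 1 + a by rewrite ltr_pwDl.
apply: (@riesz_disjoint_le _ ((1 + a) *: y) _); first last.
- by apply: riesz_leZr => //; rewrite lerDr.
- exact: riesz_scale_ge0.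
apply/riesz_disjointP; split=> // [|w wx wy].
  by apply: riesz_scale_ge0 => //; apply: ltW.
have V0 : 0 <= (1 + a)^-1 by rewrite invr_ge0 ltW.
suff /(riesz_leZl (ltW c0)) : (1 + a)^-1 *: w <= 0.
  by rewrite scalerA divff ?gt_eqF// scaler0 scale1r.
apply: dxy.
  apply: (le_trans (riesz_leZl V0 wx)); rewrite -[leRHS]scale1r.
  by apply: riesz_leZr => //; rewrite invf_le1// lerDl.
by apply: (le_trans (riesz_leZl V0 wy)); rewrite scalerA mulVf ?gt_eqF// scale1r.
Qed.

Lemma riesz_disjoint_sum (I : eqType) (r : seq I) x (F : I -> E) : 0 <= x ->
  (forall i, i \in r -> riesz_disjoint x (F i)) ->
  riesz_disjoint x (\sum_(i <- r) F i).
Proof.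
move=> x0 xF; rewrite big_seq; elim/big_ind: _ => //.
- exact: riesz_disjoint0.
- exact: riesz_disjointD.
Qed.

(** The vector [x + y - z] is below both [x] and [y]. *)
Lemma riesz_disjoint_addle x y z :
  riesz_disjoint x y -> x <= z -> y <= z -> x + y <= z.
Proof.
move=> /riesz_disjointP[x0 y0 xy] xz yz; rewrite -riesz_subr_ge0 -riesz_leN.
rewrite oppr0 opprB; apply: xy; rewrite riesz_lerBlDr.
  exact: riesz_leD.
by rewrite addrC riesz_leD.
Qed.

Lemma riesz_disjoint_refl x : riesz_disjoint x x -> x = 0.
Proof.
by move=> /riesz_disjointP[x0 _ /(_ x (lexx _) (lexx _)) x0']; apply/le_anti/andP.
Qed.

(** If [z] is below both parts, then [riesz_pos x - z] still dominates [x] and 0, hence dominates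
    [riesz_pos x]. *)
Lemma riesz_disjoint_pos x : riesz_disjoint (riesz_pos x) (riesz_pos (- x)).
Proof.
apply/riesz_disjointP; split; rewrite ?riesz_pos_ge0// => z zx zNx.
have : riesz_pos x <= riesz_pos x - z.
  rewrite riesz_pos_le riesz_subr_ge0 zx andbT riesz_lerBrDr.
  rewrite {1}[x]riesz_posB -addrA addrC -{2}[riesz_pos x]add0r riesz_leDr.
  by rewrite addrC riesz_lerBlDr add0r.
by rewrite riesz_lerBrDr addrC -{2}[riesz_pos x]add0r riesz_leDr.
Qed.

(** * Consequences of the Archimedean property *)

Hypothesis archE : archimedean_riesz E.

Lemma riesz_le0_eps x z :
  0 <= x -> (forall a, 0 < a -> z <= a *: x) -> z <= 0.
Proof.
move=> x0 zx; apply: riesz_pos_eq0; apply: (archE (y := x)); rewrite ?riesz_pos_ge0//.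
case=> [|n]; first by rewrite mulr0n.
have n0 : 0 < n.+1%:R^-1 :> R by rewrite invr_gt0.
have : riesz_pos z <= n.+1%:R^-1 *: x.
  by rewrite riesz_pos_le zx// riesz_scale_ge0// ltW.
move=> /(riesz_leZl (ler0n R n.+1)).
by rewrite scalerA divff ?pnatr_eq0// scale1r scaler_nat.
Qed.

(** The coefficient is the supremum of all [c] with [c *: x <= y]. Were this set unbounded, every
    multiple of [x] would lie below [y]; the supremum is attained by [riesz_le0_eps]. *)
Lemma max_coef x y : 0 < x -> 0 <= y ->
  exists c, [/\ 0 <= c, c *: x <= y & forall d, d *: x <= y -> d <= c].
Proof.
move=> x0 y0; set S := [set c | c *: x <= y]%classic.
have S0 : S 0 by rewrite /S/= scale0r.
have Sb : has_ubound S.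
  apply: contrapT => /forallNP Sb; suff x00 : x = 0 by rewrite x00 ltxx in x0.
  apply: (archE (y := y)); [exact: ltW | move=> n].
  have /existsNP[d /not_implyP[Sd /negP]] := Sb n%:R.
  rewrite -ltNge -scaler_nat => nd; apply: le_trans Sd.
  by apply: riesz_leZr; apply: ltW.
have supS : has_sup S by split=> //; exists 0.
exists (sup S); split.
- exact: sup_upper_bound.
- rewrite -riesz_subr_ge0 -riesz_leN oppr0 opprB.
  apply: (riesz_le0_eps (x := x)); first exact: ltW.
  move=> e e0; have [d Sd dlt] := sup_adherent e0 supS.
  rewrite riesz_lerBlDr; apply: (@le_trans _ _ (e *: x + d *: x)).
    rewrite -scalerDl; apply: riesz_leZr; first exact: ltW.
    by rewrite -lerBlDl ltW.
  exact: riesz_leD.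
- by move=> d Sd; apply: sup_upper_bound.
Qed.

End RieszTheory.

(** * Maximal disjoint families and the basis of atoms *)

Section AtomBasis.
Variables (R : realType) (E : finDimRieszType R).
Hypothesis archE : archimedean_riesz E.
Implicit Types (x y z u v : E) (a c d : R) (X : seq E).

Definition disjoint_family X : Prop :=
  [/\ uniq X, {in X, forall x, 0 < x} &
      {in X &, forall x y, x != y -> riesz_disjoint x y}].

Lemma disjoint_family_tail x X :
  disjoint_family (x :: X) ->
  [/\ 0 < x, {in X, forall y, riesz_disjoint x y} & disjoint_family X].
Proof.
move=> [/= /andP[xX uX] pX dX]; split; first by rewrite pX ?mem_head.
  move=> y yX; apply: dX; rewrite ?mem_head ?in_cons ?yX ?orbT//.
  by apply: contraNneq xX => ->.
split=> // [y yX|y z yX zX]; first by apply: pX; rewrite in_cons yX orbT.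
by apply: dX; rewrite in_cons ?yX ?zX orbT.
Qed.

Lemma disjoint_family_cons x X :
  0 < x -> {in X, forall y, riesz_disjoint x y} -> disjoint_family X ->
  disjoint_family (x :: X).
Proof.
move=> x0 xX [uX pX dX]; split=> /=.
- rewrite uX andbT; apply/negP => /xX /riesz_disjoint_refl x00.
  by rewrite x00 ltxx in x0.
- by move=> y; rewrite in_cons => /predU1P[->//|/pX].
- move=> y z; rewrite !in_cons => /predU1P[->|yX] /predU1P[->|zX] yz.
  + by rewrite eqxx in yz.
  + exact: xX.
  + by rewrite riesz_disjointC xX.
  + exact: dX.
Qed.

Lemma disjoint_family_rem x X : disjoint_family X -> disjoint_family (rem x X).
Proof.
move=> [uX pX dX]; split; first exact: rem_uniq.
  by move=> y /mem_rem /pX.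
by move=> y z /mem_rem yX /mem_rem zX; apply: dX.
Qed.

(** A member that is a combination of the others lies below a vector disjoint from it, so it is not
    strictly positive. *)
Lemma disjoint_family_free X : disjoint_family X -> free X.
Proof.
elim: X => [|x X IH]; first by rewrite nil_free.
move=> /disjoint_family_tail[x0 dx /IH fX]; rewrite free_cons fX andbT.
apply/negP => xX; have := lexx x; rewrite {2}(coord_span (X := in_tuple X) xX).
set S := \sum_i _ => xS.
(* Absolute values of the coefficients enlarge the sum and keep every term disjoint from [x]. *)
pose T := \sum_(i < size X) `|coord (in_tuple X) i x| *: X`_i.
have dT : riesz_disjoint x T.
  apply: riesz_disjoint_sum => [|i _]; first exact: ltW.
  by apply: riesz_disjointZ => //; apply/dx/mem_nth.
have xT : x <= T.
  apply: le_trans xS _; rewrite -riesz_subr_ge0 -sumrB.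
  apply: riesz_sum_ge0 => i _; rewrite riesz_subr_ge0.
  have /dx/riesz_disjointP[_ Xi _] := mem_nth 0 (ltn_ord i).
  by apply: riesz_leZr => //; apply: ler_norm.
have /riesz_disjointP[_ _ /(_ x (lexx x) xT)] := dT.
by move/(lt_le_trans x0); rewrite ltxx.
Qed.

Definition maximal_disjoint_family X : Prop :=
  disjoint_family X /\ forall Y, disjoint_family Y -> (size Y <= size X)%N.

Lemma maximal_disjoint_family_exists : exists X, maximal_disjoint_family X.
Proof.
pose P n := `[< exists X, disjoint_family X /\ size X = n >].
have exP : exists n, P n by exists 0%N; apply/asboolP; exists [::].
have ubP n : P n -> (n <= \dim {:E})%N.
  move=> /asboolP[X [/disjoint_family_free]]; rewrite /free => /eqP <- <-.
  by rewrite dimvS// subvf.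
case: (ex_maxnP exP ubP) => n /asboolP[X [dX <-]] maxX.
by exists X; split=> // Y dY; apply: maxX; apply/asboolP; exists Y.
Qed.

Section Maximal.
Variable X : seq E.
Hypothesis maxX : maximal_disjoint_family X.
Let dX : disjoint_family X := maxX.1.

(** Otherwise [y] could be added to the family. *)
Lemma maximal_disjoint_total y :
  0 <= y -> {in X, forall x, riesz_disjoint x y} -> y = 0.
Proof.
move=> y0 yX; apply/eqP; apply: contraT => yN0.
have : disjoint_family (y :: X).
  apply: disjoint_family_cons => //; first by rewrite lt_def yN0.
  by move=> x xX; rewrite riesz_disjointC yX.
by move/maxX.2; rewrite /= ltnn.
Qed.

(* Otherwise [x] could be replaced by [u] and [v] in the family. *)
Lemma maximal_disjoint_no_split x u v : x \in X ->
  u <= x -> v <= x -> riesz_disjoint u v -> u = 0 \/ v = 0.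
Proof.
move=> xX ux vx uv; have /riesz_disjointP[u0 v0 _] := uv.
have [->|uN0] := eqVneq u 0; first by left.
have [->|vN0] := eqVneq v 0; first by right.
have [uX pX djX] := dX.
have remX w : 0 <= w -> w <= x -> {in rem x X, forall y, riesz_disjoint w y}.
  move=> w0 wx y; rewrite mem_rem_uniq// => /andP[yx yX].
  by rewrite riesz_disjointC; apply: (riesz_disjoint_le (y := x)) => //; apply: djX.
have : disjoint_family [:: u, v & rem x X].
  apply: disjoint_family_cons; first by rewrite lt_def uN0.
    by move=> y; rewrite in_cons => /predU1P[->//|]; apply: remX.
  apply: disjoint_family_cons; first by rewrite lt_def vN0.
    exact: remX.
  exact: disjoint_family_rem.
move/maxX.2; rewrite /= size_rem// prednK ?ltnn//.
by case: (X) xX.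
Qed.

(** Let [c] be the largest coefficient with [c *: x <= y]. For [d > c] the positive and negative
    parts of [y - d *: x] are disjoint, so by [maximal_disjoint_no_split] one vanishes once both are
    below [x]. It must be the positive part, since [d *: x <= y] contradicts the choice of [c]; then
    [d] tends to [c]. *)
Lemma maximal_disjoint_atom x y : x \in X -> 0 <= y -> y <= x ->
  exists c, y = c *: x.
Proof.
move=> xX y0 yx; have [_ /(_ x xX) x0 _] := dX.
have [c [c0 cx maxc]] := max_coef archE x0 y0.
exists c; apply/le_anti; rewrite cx andbT.
rewrite -riesz_subr_ge0 -riesz_leN oppr0 opprB.
apply: (riesz_le0_eps archE (x := x)); first exact: ltW.
move=> e e0; rewrite riesz_lerBlDr -scalerDl; set d := e + c.
(* The splitting needs [d <= 1], to keep [d *: x - y] below [x]. For larger [d], [y <= x] already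
   suffices. *)
have [d1|/ltW d1] := leP 1 d.
  by apply: (le_trans yx); rewrite -{1}[x]scale1r; apply: riesz_leZr => //; apply: ltW.
have d0 : 0 <= d by rewrite addr_ge0 // ltW.
have := maximal_disjoint_no_split xX _ _ (riesz_disjoint_pos (y - d *: x)).
case.
- rewrite riesz_pos_le (ltW x0) andbT riesz_lerBlDr; apply: (le_trans yx).
  by apply: riesz_lerDl; apply: riesz_scale_ge0 => //; apply: ltW.
- rewrite opprB riesz_pos_le (ltW x0) andbT riesz_lerBlDr.
  apply: (@le_trans _ _ x); last exact: riesz_lerDl.
  by rewrite -{2}[x]scale1r; apply: riesz_leZr => //; apply: ltW.
- by move/riesz_pos_eq0; rewrite riesz_lerBlDr add0r.
- move/riesz_pos_eq0; rewrite opprB riesz_lerBlDr add0r => /maxc.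
  by rewrite gerDr leNgt e0.
Qed.

Lemma disjoint_sum_le (Y : seq E) (c : E -> R) y : disjoint_family Y ->
  0 <= y -> (forall x, 0 <= c x) -> {in Y, forall x, c x *: x <= y} ->
  \sum_(x <- Y) c x *: x <= y.
Proof.
move=> + y0 c0; elim: Y => [|x Y IH]; first by rewrite big_nil.
move=> /disjoint_family_tail[x0 dx dY] cy; rewrite big_cons.
apply: riesz_disjoint_addle; last 2 first.
- by apply: cy; rewrite mem_head.
- by apply: IH => // z zY; apply: cy; rewrite in_cons zY orbT.
apply: riesz_disjoint_sum => [|z /dx xz]; first by rewrite riesz_scale_ge0 // ltW.
apply: riesz_disjointZ => //; rewrite riesz_disjointC.
by apply: riesz_disjointZ => //; rewrite riesz_disjointC.
Qed.

(** Each coefficient is the largest one from [max_coef]. The remainder is positive and disjoint from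
    every member, so [maximal_disjoint_total] kills it. *)
Lemma maximal_disjoint_decomp y : 0 <= y ->
  exists2 c : E -> R, (forall x, 0 <= c x) & y = \sum_(x <- X) c x *: x.
Proof.
move=> y0; have [uX pX djX] := dX.
(* Choice asks for a coefficient at every vector; off [X] it is 0. *)
have /choice[c cP] : forall x, exists c, 0 <= c /\
    (x \in X -> c *: x <= y /\ forall d, d *: x <= y -> d <= c).
  move=> x; have [xX|_] := boolP (x \in X); last by exists 0.
  by have [c []] := max_coef archE (pX x xX) y0; exists c.
have c0 x : 0 <= c x by case: (cP x).
exists c => //; apply/eqP; rewrite -subr_eq0; apply/eqP.
set z := y - _; have z0 : 0 <= z.
  by rewrite riesz_subr_ge0 disjoint_sum_le// => x /(cP x).2[].
apply: maximal_disjoint_total => // x xX.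
have x0 := pX x xX; apply/riesz_disjointP; split=> //; first exact: ltW.
move=> w wx wz; apply: riesz_pos_eq0.
have [d dE] : exists d, riesz_pos w = d *: x.
  apply: (maximal_disjoint_atom (x := x)) => //; first exact: riesz_pos_ge0.
  by rewrite riesz_pos_le wx ltW.
(* Adding [d *: x], which is below the remainder, to the term at [x] stays below [y], so maximality
   of [c x] forbids [d > 0]. *)
have d0 : d <= 0.
  have [_ /(_ xX)[_ /(_ (d + c x))]] := cP x.
  rewrite gerDr; apply; rewrite scalerDl -dE addrC.
  apply: (@le_trans _ _ (\sum_(x <- X) c x *: x + z)); last first.
    by rewrite addrC subrK.
  apply: riesz_leD; last by rewrite riesz_pos_le wz.
  rewrite (big_rem x xX)/= riesz_lerDl// big_seq riesz_sum_ge0// => u uX'.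
  by rewrite riesz_scale_ge0// ltW// pX// (mem_rem uX').
apply/le_anti; rewrite riesz_pos_ge0 andbT dE -(scale0r x).
by apply: riesz_leZr => //; apply: ltW.
Qed.

Lemma maximal_disjoint_basis : basis_of fullv X.
Proof.
rewrite basisEfree disjoint_family_free// subvf/=.
rewrite -(eqP (disjoint_family_free dX : \dim <<X>> == size X)).
have pos_span y : 0 <= y -> y \in <<X>>%VS.
  move=> /maximal_disjoint_decomp[c _ ->]; rewrite big_seq; apply: memv_suml => x xX.
  by rewrite memvZ// memv_span.
apply/dimvS/subvP => y _; rewrite [y]riesz_posB.
by rewrite rpredB// pos_span// riesz_pos_ge0.
Qed.

End Maximal.

(** By freeness the coordinates of a positive vector are the nonnegative coefficients of
    [maximal_disjoint_decomp]. *)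
Lemma atom_basis : exists n (e : n.-tuple E),
  basis_of fullv e /\ forall x, 0 <= x <-> forall i, 0 <= coord e i x.
Proof.
have [X maxX] := maximal_disjoint_family_exists.
have bX := maximal_disjoint_basis maxX.
have [[uX pX _] _] := maxX.
exists (size X), (in_tuple X); split=> // x; split=> [x0 i|cx].
  have [c c0 ->] := maximal_disjoint_decomp maxX x0.
  rewrite (big_nth 0) big_mkord linear_sum/= sumr_ge0// => j _.
  by rewrite linearZ/= (coord_free (X := in_tuple X)) ?(basis_free bX)// mulr_ge0.
rewrite (coord_basis (X := in_tuple X) bX (memvf x)); apply: riesz_sum_ge0 => i _.
by rewrite riesz_scale_ge0// ltW// pX// mem_nth.
Qed.

End AtomBasis.

(** * Ideals, bands and order direct sums in atom coordinates *)

Section Coordinates.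
Variables (R : realType) (E : finDimRieszType R) (n : nat) (e : n.-tuple E).
Hypothesis basis_e : basis_of fullv e.
Hypothesis ge0_coord : forall x, 0 <= x <-> forall i, 0 <= coord e i x.
Implicit Types (x y z : E) (A : {set 'I_n}) (B V : {vspace E}).
Implicit Types Q : {set {set 'I_n}}.

Lemma coord_atom (i j : 'I_n) : coord e i e`_j = (j == i)%:R.
Proof. exact: coord_free (basis_free basis_e). Qed.

Lemma coordK x : x = \sum_i coord e i x *: e`_i.
Proof. exact: coord_basis basis_e (memvf x). Qed.

Lemma coord_inj x y : (forall i, coord e i x = coord e i y) -> x = y.
Proof.
by move=> xy; rewrite [x]coordK [y]coordK; apply: eq_bigr => i _; rewrite xy.
Qed.

Lemma coord_sumZ (a : 'I_n -> R) i : coord e i (\sum_j a j *: e`_j) = a i.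
Proof. exact: coord_sum_free (basis_free basis_e). Qed.

Lemma le_coord x y : x <= y <-> forall i, coord e i x <= coord e i y.
Proof.
rewrite -riesz_subr_ge0 ge0_coord.
by split=> xy i; have := xy i; rewrite linearB/= subr_ge0.
Qed.

Lemma atom_ge0 (i : 'I_n) : 0 <= e`_i.
Proof. by apply/ge0_coord => j; rewrite coord_atom. Qed.

Lemma atom_neq0 (i : 'I_n) : e`_i != 0.
Proof.
apply/eqP => /(congr1 (coord e i)); rewrite coord_atom eqxx linear0 => /eqP.
by rewrite oner_eq0.
Qed.

(** The vector of absolute values of the coordinates is the least upper bound of [x] and [- x] in
    the coordinatewise order. *)
Lemma coord_abs x i : coord e i (riesz_abs x) = `|coord e i x|.
Proof.
suff -> : riesz_abs x = \sum_j `|coord e j x| *: e`_j by rewrite coord_sumZ.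
apply/le_anti/andP; split.
  by rewrite riesz_leUx; apply/andP; split; apply/le_coord => j;
    rewrite coord_sumZ ?linearN ?ler_norm// -normrN ler_norm.
have := lexx (riesz_abs x); rewrite {1}/riesz_abs riesz_leUx.
move=> /andP[/le_coord xa /le_coord Nxa]; apply/le_coord => j.
rewrite coord_sumZ ler_norml xa andbT lerNl.
by have := Nxa j; rewrite linearN.
Qed.

Definition atom_span A := (\sum_(i in A) <[e`_i]>)%VS.

Lemma mem_atom_span A x :
  x \in atom_span A <-> forall i, i \notin A -> coord e i x = 0.
Proof.
split=> [/memv_sumP[v vA ->] i iA|xA].
  rewrite linear_sum/= big1// => j jA; have /vlineP[a ->] := vA j jA.
  rewrite linearZ/= coord_atom; case: eqP => [ji|]; last by rewrite mulr0.
  by rewrite -ji jA in iA.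
rewrite [x]coordK; apply: memv_suml => i _.
have [iA|/xA->] := boolP (i \in A); last by rewrite scale0r mem0v.
by apply: rpredZ; apply: (subvP (sumv_sup i iA (subvv _))); apply: memv_line.
Qed.

Lemma atom_in_span A (i : 'I_n) : (e`_i \in atom_span A) = (i \in A).
Proof.
apply/idP/idP => [/mem_atom_span eA|iA].
  apply/negP => /negP/eA/eqP.
  by rewrite coord_atom eqxx oner_eq0.
by apply/mem_atom_span => j; rewrite coord_atom; case: eqP => // <-; rewrite iA.
Qed.

Lemma atom_spanS A A' : (atom_span A <= atom_span A')%VS = (A \subset A').
Proof.
apply/subvP/subsetP => [AA' i|AA' x /mem_atom_span xA].
  by rewrite -!atom_in_span; apply: AA'.
by apply/mem_atom_span => i iA'; apply: xA; apply: contra iA'; apply: AA'.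
Qed.

Lemma atom_span_inj : injective atom_span.
Proof. by move=> A A' eqA; apply/setP=> i; rewrite -!atom_in_span eqA. Qed.

Lemma atom_span0 : atom_span set0 = 0%VS.
Proof. exact: big_set0. Qed.

Lemma atom_spanT : atom_span setT = fullv.
Proof.
by apply/vspaceP => x; rewrite memvf; apply/mem_atom_span => i; rewrite inE.
Qed.

(** Only the upper bound is direct; applied to the complement of [A], it forces equality because the
    two spans together fill [E]. *)
Lemma dim_atom_span A : \dim (atom_span A) = #|A|.
Proof.
have le_card A' : (\dim (atom_span A') <= #|A'|)%N.
  have -> : atom_span A' = <<map (fun i : 'I_n => e`_i) (enum A')>>%VS.
    by rewrite span_def big_map big_enum.
  by rewrite (leq_trans (dim_span _))// size_map cardE.
apply/eqP; rewrite eqn_leq le_card/= -(leq_add2r #|~: A|) cardsC card_ord.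
have dimT : \dim (atom_span A + atom_span (~: A))%VS = n.
  rewrite -[RHS](size_basis basis_e) -atom_spanT /atom_span.
  by congr (\dim _); rewrite [RHS](bigID (mem A))/=; congr (_ + _)%VS;
    apply: eq_bigl => i; rewrite !inE.
apply: leq_trans (eq_leq (esym dimT)) _.
apply: leq_trans (dimv_add_leqif _ _).1 _; rewrite leq_add2l; exact: le_card.
Qed.

(** The set [A'] collects the atoms in [B]. If [x] in [B] has a nonzero coordinate at [i], its
    component along the atom [i] is dominated by [x] in absolute value, so that atom is in [B]. *)
Lemma ideal_atom_span A B : ideal_in (atom_span A) B ->
  exists2 A' : {set 'I_n}, A' \subset A & B = atom_span A'.
Proof.
move=> [BA idB]; pose A' := [set i : 'I_n | e`_i \in B]%SET.
have coordB x i : x \in B -> coord e i x != 0 -> i \in A'.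
  move=> xB xi; rewrite inE -[e`_i]scale1r -(mulVf xi) -scalerA rpredZ//.
  have iA : i \in A.
    apply: contraT => iA; have /mem_atom_span/(_ i iA)/eqP := subvP BA x xB.
    by rewrite (negPf xi).
  apply: (idB _ x) => //; first by rewrite rpredZ// atom_in_span.
  apply/le_coord => j; rewrite !coord_abs linearZ/= coord_atom.
  by case: eqP => [->|_]; rewrite ?mulr1// mulr0 normr0.
exists A'; first by apply/subsetP => i; rewrite inE -atom_in_span; apply: subvP.
apply/vspaceP => x; apply/idP/idP => [xB|/mem_atom_span xA'].
  apply/mem_atom_span => i; apply: contraNeq; exact: coordB.
rewrite [x]coordK; apply: memv_suml => i _.
have [|/xA'->] := boolP (i \in A'); last by rewrite scale0r mem0v.
by rewrite inE; apply: rpredZ.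
Qed.

Lemma band_atom_span A A' : A' \subset A -> band_in (atom_span A) (atom_span A').
Proof.
move=> AA'; split; first split; first by rewrite atom_spanS.
  move=> x y xA /mem_atom_span yA' /le_coord xy; apply/mem_atom_span => i /yA' yi.
  by have := xy i; rewrite !coord_abs yi normr0 normr_le0 => /eqP.
move=> D x DA' [xA ubx lubx]; apply/mem_atom_span => i iA'.
have [iA|iA] := boolP (i \in A); last by have /mem_atom_span/(_ i iA) := xA.
have Di y : D y -> coord e i y = 0 by move/DA'/mem_atom_span; apply.
(* Lowering [x] by [d] at [i] keeps an upper bound of [D], whose members vanish at [i]. The bound on
   [d] is asked only in the presence of a member of [D], so it is vacuous for empty [D]. *)
have lower d : 0 <= d -> (forall y, D y -> d <= coord e i x) -> d <= 0.
  move=> d0 dx; have : x <= x - d *: e`_i.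
    apply: lubx; first by rewrite rpredB// rpredZ// atom_in_span.
    move=> y Dy; apply/le_coord => j; rewrite linearB linearZ/= coord_atom.
    have /le_coord yx := ubx _ Dy.
    case: eqP => [<-|_]; last by rewrite mulr0 subr0.
    by rewrite mulr1 (Di y Dy) subr_ge0 (dx y).
  move/le_coord/(_ i); rewrite linearB linearZ/= coord_atom eqxx mulr1.
  by rewrite lerBrDr gerDl.
apply/le_anti/andP; split.
  rewrite leNgt; apply/negP => xi.
  by have := lower _ (ltW xi) (fun _ _ => lexx _); rewrite leNgt xi.
rewrite leNgt; apply/negP => xi.
(* A negative coordinate at [i] forces [D] to be empty, and then [x] could be lowered by a whole
   atom. *)
suff /(lower 1 ler01) : forall y, D y -> 1 <= coord e i x by rewrite ler10.
move=> y Dy.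
have /le_coord/(_ i) := ubx _ Dy; rewrite (Di y Dy) => /(lt_le_trans xi).
by rewrite ltxx.
Qed.

(** Over disjoint index sets, each coordinate of the sum comes from a single component, so
    positivity is tested componentwise. *)
Lemma order_direct_sum_atom_span Q (S : set {vspace E}) :
  trivIset Q ->
  (forall B, S B <-> exists2 A : {set 'I_n}, A \in Q & B = atom_span A) ->
  order_direct_sum S (atom_span (cover Q)).
Proof.
move=> tQ SQ; exists [seq atom_span A | A <- enum Q].
have sumE : (\sum_(B <- [seq atom_span A | A <- enum Q]) B)%VS =
    atom_span (cover Q).
  by rewrite big_map big_enum/= /atom_span (big_trivIset _ tQ).
have spanQ A : A \in Q -> atom_span A \in [seq atom_span A | A <- enum Q].
  by move=> AQ; rewrite map_f// mem_enum.
split=> //.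
- by rewrite map_inj_uniq ?enum_uniq//; apply: atom_span_inj.
- move=> B; rewrite SQ; split=> [[A AQ ->]|/mapP[A]]; first exact: spanQ.
  by rewrite mem_enum => AQ ->; exists A.
(* Directness is a dimension count: [trivIset] is by definition the equality of cardinalities that
   is left. *)
- rewrite directvE/= sumE dim_atom_span big_map big_enum/=.
  under eq_bigr do rewrite dim_atom_span.
  by rewrite eq_sym.
move=> x xB; have coordS A i : A \in Q -> i \in A ->
    coord e i (\sum_(B <- [seq atom_span A | A <- enum Q]) x B) =
    coord e i (x (atom_span A)).
  move=> AQ iA; rewrite big_map big_enum/= (bigD1 A)//= linearD/= linear_sum/=.
  rewrite big1 ?addr0// => A' /andP[A'Q A'A].
  have /mem_atom_span := xB _ (spanQ _ A'Q); apply.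
  have /trivIsetP/(_ _ _ AQ A'Q) := tQ; rewrite eq_sym => /(_ A'A).
  by move/disjointFr => ->.
split=> [/ge0_coord x0 B /mapP[A]|x0].
  rewrite mem_enum => AQ ->; apply/ge0_coord => i.
  have [iA|iA] := boolP (i \in A); first by rewrite -(coordS A).
  by have /mem_atom_span-> := xB _ (spanQ _ AQ).
by rewrite big_seq; apply: riesz_sum_ge0.
Qed.

(** * The action on atoms, its orbits and the irreducible bands *)

Section Representation.
Variables (G : finGroupType) (rho : G -> 'End(E)).
Hypothesis rhoP : positive_representation rho.

Lemma rho1 x : rho 1%g x = x.
Proof.
have [/(_ 1%g)[/bij_inj inj1 _ _] rhoM] := rhoP; apply: inj1.
by have := rhoM 1%g 1%g; rewrite mulg1 => /lfunP/(_ x); rewrite comp_lfunE.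
Qed.

Lemma rhoM g h x : rho (g * h)%g x = rho g (rho h x).
Proof. by rewrite rhoP.2 comp_lfunE. Qed.

Lemma rhoK g : cancel (rho g) (rho g^-1%g).
Proof. by move=> x; rewrite -rhoM mulVg rho1. Qed.

Lemma rhoVK g : cancel (rho g^-1%g) (rho g).
Proof. by move=> x; rewrite -rhoM mulgV rho1. Qed.

Lemma rho_ge0 g x : 0 <= x -> 0 <= rho g x.
Proof.
move=> x0; have [_ joinM _] := rhoP.1 g.
have := joinM 0 x; have -> : riesz_join 0 x = x.
  apply/le_anti; rewrite riesz_leUx x0 lexx /=.
  by have := lexx (riesz_join 0 x); rewrite riesz_leUx => /andP[].
rewrite linear0 => ->.
by have := lexx (riesz_join 0 (rho g x)); rewrite riesz_leUx => /andP[].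
Qed.

(** The image of an atom dominates its component along some atom [j]. Pulled back by the inverse,
    this component lies between 0 and the original atom, hence is a multiple of it; pushing forward
    again, the image is a multiple of the atom [j]. *)
Lemma rho_atom g (i : 'I_n) :
  exists (j : 'I_n) (a : R), a != 0 /\ rho g e`_i = a *: e`_j.
Proof.
set x := rho g e`_i; have x0 : 0 <= x by rewrite rho_ge0// atom_ge0.
have [j xj] : exists j, coord e j x != 0.
  apply/existsP; apply: contraT; rewrite negb_exists => /forallP/= xj.
  have : x = 0.
    by apply: coord_inj => j; rewrite linear0; apply/eqP; rewrite -[_ == _]negbK.
  move/(congr1 (rho g^-1%g)); rewrite rhoK linear0 => /eqP.
  by rewrite (negPf (atom_neq0 i)).
pose y := rho g^-1%g (coord e j x *: e`_j).
have xj0 : 0 <= coord e j x by move/ge0_coord: x0.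
have y0 : 0 <= y by rewrite rho_ge0// riesz_scale_ge0// atom_ge0.
have yx : y <= e`_i.
  rewrite -riesz_subr_ge0 -[e`_i](rhoK g) -linearB rho_ge0//.
  rewrite riesz_subr_ge0; apply/le_coord => k; rewrite linearZ/= coord_atom.
  case: eqP => [<-|_]; rewrite ?mulr1// mulr0; move/ge0_coord: x0; exact.
have yE : y = coord e i y *: e`_i.
  apply: coord_inj => k; rewrite linearZ/= coord_atom.
  case: eqP => [<-|ik]; first by rewrite mulr1.
  rewrite mulr0; apply/le_anti; move/ge0_coord: y0 => -> /=.
  by move/le_coord: yx => /(_ k); rewrite coord_atom; case: eqP ik; rewrite ?andbT.
have xE : coord e j x *: e`_j = coord e i y *: x.
  by rewrite /x -linearZ/= -yE rhoVK.
have yi : coord e i y != 0.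
  apply: contraNneq xj => yi; move/(congr1 (coord e j)): xE.
  by rewrite yi scale0r linear0 linearZ/= coord_atom eqxx mulr1 => ->.
exists j, ((coord e i y)^-1 * coord e j x).
by rewrite mulf_neq0 ?invr_neq0// -scalerA xE scalerA mulVf// scale1r.
Qed.

(** This is the orbit relation for the action of [G] on the rays of atoms: by [rho_atom] a nonzero
    coordinate at [j] already means that the image lies on the line of the atom [j]. *)
Definition same_orbit : rel 'I_n :=
  fun i j => [exists g, coord e j (rho g e`_i) != 0].

Lemma same_orbitP (i j : 'I_n) :
  reflect (exists g (a : R), a != 0 /\ rho g e`_i = a *: e`_j) (same_orbit i j).
Proof.
apply: (iffP existsP) => -[g].
  have [k [a [a0 ge]]] := rho_atom g i.
  rewrite ge linearZ/= coord_atom; case: (k =P j) => [kj _|]; last by rewrite mulr0 eqxx.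
  by exists g, a; rewrite -kj.
move=> [a [a0 ge]]; exists g.
by rewrite ge linearZ/= coord_atom eqxx mulr1.
Qed.

Lemma same_orbit_refl : reflexive same_orbit.
Proof.
by move=> i; apply/same_orbitP; exists 1%g, 1; rewrite rho1 scale1r oner_eq0.
Qed.

Lemma same_orbit_sym i j : same_orbit i j -> same_orbit j i.
Proof.
move=> /same_orbitP[g [a [a0 ge]]]; apply/same_orbitP; exists g^-1%g, a^-1.
rewrite invr_eq0; split=> //.
by rewrite -[in RHS](rhoK g e`_i) ge linearZ/= scalerA mulVf// scale1r.
Qed.

Lemma same_orbit_trans : transitive same_orbit.
Proof.
move=> j i k /same_orbitP[g [a [a0 ge]]] /same_orbitP[h [b [b0 he]]].
apply/same_orbitP; exists (h * g)%g, (a * b).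
by rewrite mulf_neq0// rhoM ge linearZ/= he scalerA.
Qed.

Lemma same_orbit_equivalence : {in setT & &, equivalence_rel same_orbit}.
Proof.
move=> i j k _ _ _; split=> [|ij]; first exact: same_orbit_refl.
apply/idP/idP => [|]; first exact: same_orbit_trans (same_orbit_sym ij).
exact: same_orbit_trans ij.
Qed.

Lemma rho_invariant_atom_span A :
  rho_invariant rho (atom_span A) <->
  forall i j, same_orbit i j -> i \in A -> j \in A.
Proof.
split=> [invA i j /same_orbitP[g [a [a0 ge]]]|clA g].
  rewrite -!atom_in_span => /(memv_img (rho g))/(subvP (invA g)).
  by rewrite ge rpredZeq (negPf a0).
apply/subvP => _ /memv_imgP[x /mem_atom_span xA ->].
rewrite [x]coordK linear_sum; apply: memv_suml => i _; rewrite linearZ/=.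
have [iA|/xA->] := boolP (i \in A); last by rewrite scale0r mem0v.
have [j [a [a0 ge]]] := rho_atom g i.
rewrite ge !rpredZ// atom_in_span (clA i)//.
by apply/same_orbitP; exists g, a.
Qed.

Definition orbits := equivalence_partition same_orbit setT.

Lemma mem_orbits A :
  A \in orbits <-> exists i, A = [set j | same_orbit i j].
Proof.
have setE i : [set j in [set: 'I_n] | same_orbit i j] = [set j | same_orbit i j].
  by apply/setP => j; rewrite !inE.
by split=> [/imsetP[i _ ->]|[i ->]]; [exists i | rewrite -setE; apply: imset_f].
Qed.

(** A nonempty stable index set contains the orbit of each of its points, whose span is a nonzero
    invariant band; irreducibility makes it everything. Conversely a nonempty stable subset of an
    orbit is the whole orbit. The empty set accounts for the zero band. *)
Lemma irreducible_atom_span B :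
  irreducible_invariant_band rho B <->
  exists2 A : {set 'I_n}, A \in set0 |: orbits & B = atom_span A.
Proof.
split=> [[[]]|[A /setU1P[->|/mem_orbits[i ->]] ->]].
- rewrite -atom_spanT => /ideal_atom_span[A _ ->] _.
  move=> /rho_invariant_atom_span clA irrA; exists A => //.
  have [->|[i iA]] := set_0Vmem A; first by rewrite setU11.
  apply/setU1P; right; apply/mem_orbits; exists i.
  set O := [set j | _]; have OA : O \subset A.
    by apply/subsetP => j; rewrite inE => /clA; apply.
  have [||/eqP|/atom_span_inj->//] := irrA (atom_span O).
  + exact: band_atom_span.
  + apply/rho_invariant_atom_span => j k jk; rewrite !inE => ij.
    exact: same_orbit_trans jk.
  + rewrite -subv0 -atom_span0 atom_spanS => /subsetP/(_ i).
    by rewrite !inE same_orbit_refl => /(_ isT).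
- split.
  + by rewrite /band -atom_spanT; apply: band_atom_span; apply: sub0set.
  + by apply/rho_invariant_atom_span => j k _; rewrite inE.
  + move=> C [/ideal_atom_span[A' + ->] _ _].
    by rewrite subset0 => /eqP ->; right.
- split.
  + by rewrite /band -atom_spanT; apply: band_atom_span; apply: subsetT.
  + apply/rho_invariant_atom_span => j k jk; rewrite !inE => ij.
    exact: same_orbit_trans jk.
  + move=> C [/ideal_atom_span[A' A'O ->] _] /rho_invariant_atom_span clA'.
    have [->|[k kA']] := set_0Vmem A'; first by left; rewrite atom_span0.
    right; congr atom_span; apply/eqP; rewrite eqEsubset A'O.
    apply/subsetP => j; rewrite inE => ij; apply: (clA' k) => //.
    apply: same_orbit_trans ij; apply: same_orbit_sym.
    by have := subsetP A'O k kA'; rewrite inE.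
Qed.

Lemma irreducible_decomposition :
  order_direct_sum (irreducible_invariant_band rho) fullv.
Proof.
have /and3P[/eqP covO tO _] := equivalence_partitionP same_orbit_equivalence.
rewrite -atom_spanT.
(* Adjoining the empty set changes neither the union nor disjointness. *)
have <- : cover (set0 |: orbits) = setT.
  by rewrite -covO /cover bigcup_setU big_set1 set0U.
apply: order_direct_sum_atom_span irreducible_atom_span.
apply/trivIsetP => A A' /setU1P[->|AO] /setU1P[->|A'O].
- by rewrite eqxx.
- by rewrite -setI_eq0 set0I.
- by rewrite -setI_eq0 setI0.
- by move/trivIsetP: tO; apply.
Qed.

(** The index set of [B] is stable, hence the union of the orbits it contains; their spans are the
    summands. *)
Lemma invariant_band_decomposition B : band B -> rho_invariant rho B ->
  exists S : set {vspace E},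
    (forall C, S C -> irreducible_invariant_band rho C) /\
    order_direct_sum S B.
Proof.
move=> [+ _]; rewrite -atom_spanT => /ideal_atom_span[A _ ->].
move=> /rho_invariant_atom_span clA.
have /and3P[_ tO _] := equivalence_partitionP same_orbit_equivalence.
pose Q := [set O in orbits | O \subset A].
exists (fun B => exists2 A' : {set 'I_n}, A' \in Q & B = atom_span A'); split.
  move=> _ [A' + ->]; rewrite inE => /andP[A'O _].
  by apply/irreducible_atom_span; exists A' => //; rewrite setU1r.
have -> : A = cover Q.
  apply/setP => i; apply/idP/bigcupP => [iA|[A']]; last first.
    by rewrite inE => /andP[_ /subsetP]; apply.
  exists [set j | same_orbit i j]; last by rewrite inE same_orbit_refl.
  rewrite inE; apply/andP; split; first by apply/mem_orbits; exists i.
  by apply/subsetP => j; rewrite inE => /clA; apply.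
apply: order_direct_sum_atom_span => //.
by apply: trivIsetS tO; apply/subsetP => A'; rewrite inE => /andP[].
Qed.

End Representation.
End Coordinates.

Theorem theorem4p9 (R : realType) (E : finDimRieszType R)
    (E_archimedean : archimedean_riesz E)
    (E_neq0 : (fullv : {vspace E}) <> 0%VS)
    (G : finGroupType) (rho : G -> 'End(E))
    (rho_positive : positive_representation rho) :
  order_direct_sum (irreducible_invariant_band rho) fullv /\
  (forall B : {vspace E}, band B -> rho_invariant rho B ->
     exists S : set {vspace E},
       (forall C, S C -> irreducible_invariant_band rho C) /\
       order_direct_sum S B).
Proof.
have [n [e [basis_e ge0_coord]]] := atom_basis E_archimedean.
split; first exact: irreducible_decomposition basis_e ge0_coord _ _ rho_positive.
exact: invariant_band_decomposition basis_e ge0_coord _ _ rho_positive.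
Qed.
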